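(* Let $0<\mu_1<\mu_2$, $\alpha\in(0,1)$, $H>0$, $\delta\ge0$, $\sigma\in(0,1/2)$. Set $$\mu_3:=\frac{\mu_1\min\{1,\mu_1\}}{2\mu_2^2},\qquad \mu_5:=\frac{H}{16\,\mu_2^{(1+\alpha)/2}}.$$ Let $\{\lambda_i\}$ be a sequence of positive reals with $\lambda_i\to+\infty$. Then the set of all $c\in\mathcal{PS}(\mu_1,\mu_2,\alpha,H)$ that are universal activators for $\{\lambda_i\}$ with order $(\mu_3,\mu_5)$ is residual in $\mathcal{PS}(\mu_1,\mu_2,\alpha,H)$ (with respect to the uniform distance).
   Context: $\mathcal{PS}(\mu_1,\mu_2,\alpha,H)$ is the set of functions $c:[0,+\infty)\to[0,+\infty)$ with $\mu_1\le c(t)\le\mu_2$ for all $t\ge 0$ and $|c(t)-c(s)|\le H|t-s|^\alpha$ for all $t,s\ge0$, a complete metric space with the uniform distance; residual means containing a countable intersection of open dense sets. Universal activator: given $\alpha,\delta,\sigma$, a sequence $\{\lambda_i\}$ of positive reals and positive reals $\mu_3,\mu_5$, a continuous $c:[0,+\infty)\to\mathbb{R}$ is a universal activator for $\{\lambda_i\}$ with order $(\mu_3,\mu_5)$ if the solutions $w_i$ of $w_i''(t)+2\delta\lambda_i^{2\sigma}w_i'(t)+\lambda_i^2c(t)w_i(t)=0$, $w_i(0)=0$, $w_i'(0)=1$ satisfy $$\limsup_{i\to+\infty}\big(|w_i'(t)|^2+\lambda_i^2|w_i(t)|^2\big)\exp\big(-\mu_5\lambda_i^{1-\alpha}t+2\delta\lambda_i^{2\sigma}t\big)\ge\mu_3\qquad\forall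 t\ge0.$$ *)

(* Defs.v *)
From Stdlib Require Import Reals Lra.
Open Scope R_scope.

(* Functions [0,+oo) -> R are represented as R -> R; only values at t >= 0 matter. *)

Definition PS (mu1 mu2 alpha H : R) (c : R -> R) : Prop :=
  (forall t, 0 <= t -> mu1 <= c t <= mu2) /\
  (forall t s, 0 <= t -> 0 <= s -> Rabs (c t - c s) <= H * Rpower (Rabs (t - s)) alpha).

Definition udist_lt (c d : R -> R) (r : R) : Prop :=
  exists r', r' < r /\ forall t, 0 <= t -> Rabs (c t - d t) <= r'.

(* Derivative on [0,+oo): two-sided for t > 0, right derivative at t = 0. *)
Definition deriv_nonneg (f f' : R -> R) : Prop :=
  forall t, 0 <= t -> forall eps, 0 < eps -> exists del, 0 < del /\
    forall h, h <> 0 -> 0 <= t + h -> Rabs h < del ->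
      Rabs ((f (t + h) - f t) / h - f' t) < eps.

Definition cont_nonneg (c : R -> R) : Prop :=
  forall t, 0 <= t -> forall eps, 0 < eps -> exists del, 0 < del /\
    forall s, 0 <= s -> Rabs (s - t) < del -> Rabs (c s - c t) < eps.

(* w (with derivative w') solves  w'' + 2 delta lam^(2 sigma) w' + lam^2 c w = 0,
   w(0) = 0, w'(0) = 1, on [0,+oo). *)
Definition is_solution (delta sigma lam : R) (c w w' : R -> R) : Prop :=
  deriv_nonneg w w' /\
  deriv_nonneg w' (fun t => - (2 * delta * Rpower lam (2 * sigma)) * w' t
                             - lam ^ 2 * c t * w t) /\
  w 0 = 0 /\ w' 0 = 1.

Definition limsup_ge (a : nat -> R) (m : R) : Prop :=
  forall eps, 0 < eps -> forall N : nat, exists i : nat, (N <= i)%nat /\ m - eps < a i.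

(* Universal activator for lam with order (mu3, mu5).  Since the solution of the
   Cauchy problem is unique, "the solutions w_i" is expressed by quantifying over
   all families of solutions. *)
Definition universal_activator (alpha delta sigma : R) (lam : nat -> R)
    (mu3 mu5 : R) (c : R -> R) : Prop :=
  cont_nonneg c /\
  forall (w w' : nat -> R -> R),
    (forall i, is_solution delta sigma (lam i) c (w i) (w' i)) ->
    forall t, 0 <= t ->
      limsup_ge (fun i =>
        (Rabs (w' i t) ^ 2 + (lam i) ^ 2 * Rabs (w i t) ^ 2) *
        exp (- mu5 * Rpower (lam i) (1 - alpha) * t
             + 2 * delta * Rpower (lam i) (2 * sigma) * t)) mu3.

Definition open_in (X U : (R -> R) -> Prop) : Prop :=
  (forall c, U c -> X c) /\
  forall c, U c -> exists r, 0 < r /\ forall d, X d -> udist_lt c d r -> U d.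

Definition dense_in (X U : (R -> R) -> Prop) : Prop :=
  forall c, X c -> forall r, 0 < r -> exists d, U d /\ udist_lt c d r.

Definition residual_in (X A : (R -> R) -> Prop) : Prop :=
  exists U : nat -> (R -> R) -> Prop,
    (forall n, open_in X (U n) /\ dense_in X (U n)) /\
    (forall c, X c -> (forall n, U n c) -> A c).

(* Main.v *)
Require Import Defs.
From Stdlib Require Import Reals Lra Lia Psatz.
From Coquelicot Require Import Coquelicot.
Open Scope R_scope.

(** Baire argument. The n-th open set consists of the speeds near which some frequency
    [lam i], i >= n, has energy above [mu3] times the prescribed exponential on all of
    [[0, n]]; it is open by construction, so only density has to be proved.

    A given speed is first replaced by a smooth [M = m^2], strictly inside the constraints,
    with Hölder constant slightly below [H]. With [phi' = lam m], [D = delta lam^(2 sigma)]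
    and [a' = k sin^2 phi], [k = mu5 lam^(1-alpha)], the function
    [w = (m(0) m)^(-1/2) e^(a - D t) sin phi / lam]
    solves the equation exactly for the speed
    [M + (D/lam)^2 - 2 (k/lam) m sin (2 phi) + lower order terms]:
    the choice of [a'] makes every term of [w''] divisible by [sin phi]. The perturbation
    has size [lam^(-alpha)] and oscillates at frequency [lam], so its Hölder constant stays
    below [H/2], and it acts only at scales where the Hölder seminorm of [M] is negligible.
    Since [2a - k t] is bounded below by a vanishing quantity, the energy of [w] has the
    required growth, with a margin that a Gronwall estimate transfers to all nearby speeds. *)

(** * Smoothing within the Hölder class *)

(* [auto_derive] leaves eta-expanded [Derive (fun x => f x) t], on which plain rewriting fails. *)
Ltac rewrite_derive H t :=
  match type of (H t) with is_derive ?F _ ?l =>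
    rewrite (is_derive_unique (fun x : R => F x) t l (H t)) end;
  match goal with |- @eq _ ?a ?b => change (@eq R a b) end.

Ltac ex_derive_from H :=
  match type of H with forall t, is_derive ?F t _ =>
    match goal with |- ex_derive (fun x => F x) ?u => eexists; apply (H u) end end.

Lemma MVT_everywhere (f df : R -> R) (a b : R) :
  (forall t : R, is_derive f t (df t)) ->
  exists c, Rmin a b <= c <= Rmax a b /\ f b - f a = df c * (b - a).
Proof.
intros Hf; apply MVT_gen; intros x _; [apply Hf|].
apply derivable_continuous_pt; exists (df x); apply is_derive_Reals, Hf.
Qed.

Lemma antiderivative_exists (f : R -> R) :
  (forall t : R, continuous f t) ->
  exists F : R -> R, F 0 = 0 /\ forall t : R, is_derive F t (f t).
Proof.
intros Hf; exists (fun t => RInt f 0 t); split.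
- rewrite RInt_point; reflexivity.
- intros t; apply (is_derive_RInt f (fun t => RInt f 0 t) 0 t); [|apply Hf].
  apply filter_forall; intros y; apply (RInt_correct f).
  apply (ex_RInt_continuous f); intros z _; apply Hf.
Qed.

Lemma is_derive_continuous (f df : R -> R) :
  (forall t : R, is_derive f t (df t)) -> forall t : R, continuous f t.
Proof. intros Hf t; apply (ex_derive_continuous f); exists (df t); apply Hf. Qed.

Lemma steklov_average (f : R -> R) (h : R) :
  0 < h -> (forall t : R, continuous f t) ->
  exists g : R -> R, (forall t : R, is_derive g t ((f (t + h) - f t) / h)) /\
    (forall t, exists xi, t <= xi <= t + h /\ g t = f xi) /\
    (forall t s, exists xi, 0 <= xi /\ g t - g s = f (t + xi) - f (s + xi)).
Proof.
intros Hh Hf; destruct (antiderivative_exists f Hf) as [F [_ HF]].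
exists (fun t => (F (t + h) - F t) / h); split; [|split].
- intros t; auto_derive.
  + repeat split; eexists; apply HF.
  + rewrite_derive HF t; rewrite_derive HF (t + h).
    field; lra.
- intros t; destruct (MVT_everywhere F f t (t + h) HF) as [xi [Hxi E]].
  rewrite Rmin_left, Rmax_right in Hxi by lra.
  exists xi; split; [exact Hxi|]; rewrite E; field; lra.
- intros t s.
  destruct (MVT_everywhere (fun u => F (t + u) - F (s + u))
              (fun u => f (t + u) - f (s + u)) 0 h) as [xi [Hxi E]].
  + intros u; auto_derive.
    * repeat split; eexists; apply HF.
    * rewrite_derive HF (t + u); rewrite_derive HF (s + u); ring.
  + rewrite Rmin_left, Rmax_right in Hxi by lra.
    exists xi; split; [lra|].
    replace (f (t + xi) - f (s + xi)) with ((f (t + xi) - f (s + xi)) * (h - 0) / h) by (field; lra).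
    rewrite <- E, !Rplus_0_r; field; lra.
Qed.

Definition bdd (f : R -> R) : Prop := exists C, forall t, Rabs (f t) <= C.

Lemma bdd_const (c : R) : bdd (fun _ => c).
Proof. exists (Rabs c); intros; apply Rle_refl. Qed.

Lemma bdd_plus (f g : R -> R) : bdd f -> bdd g -> bdd (fun t => f t + g t).
Proof.
intros [A HA] [B HB]; exists (A + B); intros t.
eapply Rle_trans; [apply Rabs_triang|]; apply Rplus_le_compat; auto.
Qed.

Lemma bdd_opp (f : R -> R) : bdd f -> bdd (fun t => - f t).
Proof. intros [A HA]; exists A; intros t; rewrite Rabs_Ropp; auto. Qed.

Lemma bdd_minus (f g : R -> R) : bdd f -> bdd g -> bdd (fun t => f t - g t).
Proof. intros Hf Hg; apply (bdd_plus f (fun t => - g t)); [|apply bdd_opp]; auto. Qed.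

Lemma bdd_mult (f g : R -> R) : bdd f -> bdd g -> bdd (fun t => f t * g t).
Proof.
intros [A HA] [B HB]; exists (A * B); intros t; rewrite Rabs_mult.
apply Rmult_le_compat; auto using Rabs_pos.
Qed.

Lemma bdd_inv (f : R -> R) (a : R) : 0 < a -> (forall t, a <= f t) -> bdd (fun t => / f t).
Proof.
intros Ha Hf; exists (/ a); intros t; specialize (Hf t).
rewrite Rabs_right; [apply Rinv_le_contravar; lra|].
apply Rle_ge, Rlt_le, Rinv_0_lt_compat; lra.
Qed.

Lemma bdd_shift (f : R -> R) (h : R) : bdd f -> bdd (fun t => f (t + h)).
Proof. intros [A HA]; exists A; auto. Qed.

Lemma bdd_diffquot (f : R -> R) (h : R) : bdd f -> bdd (fun t => (f (t + h) - f t) / h).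
Proof.
intros Hf; apply (bdd_mult (fun t => f (t + h) - f t)); [|apply bdd_const].
apply bdd_minus; [apply bdd_shift|]; auto.
Qed.

Lemma is_derive_diffquot (f df : R -> R) (h : R) :
  (forall t : R, is_derive f t (df t)) ->
  forall t : R, is_derive (fun t => (f (t + h) - f t) / h) t ((df (t + h) - df t) / h).
Proof.
intros Hf t; auto_derive.
- repeat split; eexists; apply Hf.
- rewrite_derive Hf t; rewrite_derive Hf (t + h).
  unfold Rdiv; ring.
Qed.

Lemma Rpower_holder_small (H alpha eps : R) :
  0 < H -> 0 < alpha -> 0 < eps -> exists h, 0 < h /\
    forall y, 0 < y <= h -> H * Rpower y alpha <= eps.
Proof.
intros HH Ha He; exists (Rpower (eps / H) (/ alpha)); split; [apply exp_pos|].
intros y Hy.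
assert (Heh : 0 < eps / H) by (apply Rdiv_lt_0_compat; lra).
replace eps with (H * (eps / H)) by (field; lra).
apply Rmult_le_compat_l; [lra|].
rewrite <- (Rpower_1 (eps / H)) by assumption.
replace 1 with (/ alpha * alpha) by (field; lra).
rewrite <- Rpower_mult; apply Rle_Rpower_l; lra.
Qed.

Definition smooth3 (M M1 M2 M3 : R -> R) : Prop :=
  (forall t : R, is_derive M t (M1 t)) /\ (forall t : R, is_derive M1 t (M2 t)) /\
  (forall t : R, is_derive M2 t (M3 t)) /\ bdd M1 /\ bdd M2 /\ bdd M3.

Lemma PS_continuous_extension (mu1 mu2 alpha H : R) (c : R -> R) :
  0 < alpha -> 0 < H -> PS mu1 mu2 alpha H c ->
  (forall t : R, continuous (fun t => c (Rmax 0 t)) t) /\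
  (forall t s, t <> s ->
     Rabs (c (Rmax 0 t) - c (Rmax 0 s)) <= H * Rpower (Rabs (t - s)) alpha).
Proof.
intros Ha HH [_ Hc].
assert (Hol : forall t s, t <> s ->
     Rabs (c (Rmax 0 t) - c (Rmax 0 s)) <= H * Rpower (Rabs (t - s)) alpha).
{ intros t s Hts; destruct (Req_dec (Rmax 0 t) (Rmax 0 s)) as [E|NE].
  - rewrite E; unfold Rminus at 1; rewrite Rplus_opp_r, Rabs_R0.
    apply Rlt_le, Rmult_lt_0_compat; [lra|apply exp_pos].
  - eapply Rle_trans; [apply Hc; apply Rmax_l|].
    apply Rmult_le_compat_l; [lra|]; apply Rle_Rpower_l; [lra|]; split.
    + apply Rabs_pos_lt; lra.
    + unfold Rmax; destruct (Rle_dec 0 t), (Rle_dec 0 s); unfold Rabs;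
        repeat destruct (Rcase_abs _); lra. }
split; [|exact Hol].
intros t; apply continuity_pt_filterlim; intros eps He.
destruct (Rpower_holder_small H alpha (eps / 2)) as [h [Hh Hs]]; [lra..|].
exists h; split; [exact Hh|].
intros s [[_ Hts] Hd]; simpl in *; unfold Rdist in *.
assert (0 < Rabs (s - t)) by (apply Rabs_pos_lt; lra).
specialize (Hs (Rabs (s - t))); specialize (Hol s t); lra.
Qed.

Lemma smooth_approximation (mu1 mu2 alpha H r : R) (c : R -> R) :
  0 < mu1 -> mu1 < mu2 -> 0 < alpha -> 0 < H -> 0 < r -> PS mu1 mu2 alpha H c ->
  exists (M M1 M2 M3 : R -> R) (eta : R), smooth3 M M1 M2 M3 /\ 0 < eta /\
    (forall t, mu1 + eta <= M t <= mu2 - eta) /\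
    (forall t, 0 <= t -> Rabs (M t - c t) <= r) /\
    (forall t s, t <> s -> Rabs (M t - M s) <= (1 - eta) * (H * Rpower (Rabs (t - s)) alpha)).
Proof.
intros Hmu1 Hmu2 Ha HH Hr Hc.
destruct (PS_continuous_extension mu1 mu2 alpha H c Ha HH Hc) as [Hcont Hol].
destruct Hc as [Hb _].
set (f0 := fun t => c (Rmax 0 t)) in *.
assert (Hb0 : forall t, mu1 <= f0 t <= mu2) by (intros t; apply Hb, Rmax_l).
destruct (Rpower_holder_small H alpha (r / 2)) as [h3 [Hh3 Hs]]; [lra..|].
set (h := h3 / 3); assert (Hh : 0 < h) by (unfold h; lra).
destruct (steklov_average f0 h Hh Hcont) as [f1 [D1 [V1 C1]]].
assert (Hcont1 := is_derive_continuous _ _ D1).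
destruct (steklov_average f1 h Hh Hcont1) as [f2 [D2 [V2 C2]]].
assert (Hcont2 := is_derive_continuous _ _ D2).
destruct (steklov_average f2 h Hh Hcont2) as [f3 [D3 [V3 C3]]].
assert (V : forall t, exists xi, t <= xi <= t + h3 /\ f3 t = f0 xi).
{ intros t; destruct (V3 t) as [x3 [I3 ->]]; destruct (V2 x3) as [x2 [I2 ->]];
  destruct (V1 x2) as [x1 [I1 ->]]; exists x1; split; [unfold h in *; lra|reflexivity]. }
assert (C : forall t s, t <> s -> Rabs (f3 t - f3 s) <= H * Rpower (Rabs (t - s)) alpha).
{ intros t s Hts; destruct (C3 t s) as [x3 [_ ->]].
  destruct (C2 (t + x3) (s + x3)) as [x2 [_ ->]].
  destruct (C1 (t + x3 + x2) (s + x3 + x2)) as [x1 [_ ->]].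
  eapply Rle_trans; [apply Hol; lra|].
  right; do 3 f_equal; ring. }
pose (q := Rmin (1 / 2) (r / 2 / (mu2 - mu1))).
assert (Hq1 : 0 < q).
{ apply Rmin_case; [lra|]; apply Rdiv_lt_0_compat; lra. }
assert (Hq2 : q * (mu2 - mu1) <= r / 2).
{ replace (r / 2) with (r / 2 / (mu2 - mu1) * (mu2 - mu1)) by (field; lra).
  apply Rmult_le_compat_r; [lra|]; apply Rmin_r. }
assert (Hq3 : q <= 1 / 2) by apply Rmin_l.
pose (dq := fun f t => (f (t + h) - f t) / h).
assert (B0 : bdd f0).
{ exists mu2; intros t; specialize (Hb0 t); rewrite Rabs_right; lra. }
assert (Sc : forall f df, (forall t : R, is_derive f t (df t)) ->
   forall t : R, is_derive (fun t => (1 - q) * f t) t ((1 - q) * df t)).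
{ intros f df Hf t; auto_derive; [eexists; apply Hf|].
  rewrite_derive Hf t; ring. }
exists (fun t => (1 - q) * f3 t + q * ((mu1 + mu2) / 2)),
  (fun t => (1 - q) * dq f2 t), (fun t => (1 - q) * dq (dq f1) t),
  (fun t => (1 - q) * dq (dq (dq f0)) t), (Rmin q (q * ((mu2 - mu1) / 2))).
assert (F0 : forall t, mu1 <= f3 t <= mu2).
{ intros t; destruct (V t) as [xi [_ ->]]; apply Hb0. }
assert (Hqm : 0 < q * (mu2 - mu1)) by (apply Rmult_lt_0_compat; lra).
split; [|split; [|split; [|split]]].
- split; [|split; [|split; [|split; [|split]]]].
  + intros t; auto_derive; [eexists; apply D3|].
    rewrite_derive D3 t; unfold dq; ring.
  + apply Sc; exact (is_derive_diffquot _ _ h D2).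
  + apply Sc; refine (is_derive_diffquot _ _ h _); exact (is_derive_diffquot _ _ h D1).
  + apply bdd_mult; [apply bdd_const|]; apply bdd_diffquot.
    exists mu2; intros t; destruct (V2 t) as [x2 [_ ->]]; destruct (V1 x2) as [x1 [_ ->]].
    specialize (Hb0 x1); rewrite Rabs_right; lra.
  + apply bdd_mult; [apply bdd_const|]; do 2 apply bdd_diffquot.
    exists mu2; intros t; destruct (V1 t) as [x1 [_ ->]].
    specialize (Hb0 x1); rewrite Rabs_right; lra.
  + apply bdd_mult; [apply bdd_const|]; do 3 apply bdd_diffquot; exact B0.
- apply Rmin_case; lra.
- intros t; assert (Hm := Rmin_r q (q * ((mu2 - mu1) / 2))); specialize (F0 t).
  assert ((1 - q) * mu1 <= (1 - q) * f3 t <= (1 - q) * mu2)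
    by (split; apply Rmult_le_compat_l; lra); lra.
- intros t Ht.
  assert (E3 : Rabs (f3 t - c t) <= r / 2).
  { destruct (V t) as [xi [I ->]].
    replace (c t) with (f0 t) by (unfold f0; rewrite Rmax_right; auto).
    destruct (Req_dec xi t) as [->|NE].
    - unfold Rminus; rewrite Rplus_opp_r, Rabs_R0; lra.
    - eapply Rle_trans; [apply Hol; exact NE|].
      apply Hs; rewrite Rabs_right; lra. }
  specialize (F0 t); specialize (Hb t Ht).
  replace ((1 - q) * f3 t + q * ((mu1 + mu2) / 2) - c t) with
    ((f3 t - c t) + q * ((mu1 + mu2) / 2 - f3 t)) by ring.
  eapply Rle_trans; [apply Rabs_triang|].
  rewrite (Rabs_mult q), (Rabs_right q) by lra.
  assert (q * Rabs ((mu1 + mu2) / 2 - f3 t) <= q * (mu2 - mu1)).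
  { apply Rmult_le_compat_l; [lra|]; unfold Rabs; destruct (Rcase_abs _); lra. }
  lra.
- intros t s Hts; specialize (C t s Hts).
  assert (Hm := Rmin_l q (q * ((mu2 - mu1) / 2))).
  replace ((1 - q) * f3 t + q * ((mu1 + mu2) / 2) - ((1 - q) * f3 s + q * ((mu1 + mu2) / 2)))
    with ((1 - q) * (f3 t - f3 s)) by ring.
  rewrite Rabs_mult, (Rabs_right (1 - q)) by lra.
  apply Rmult_le_compat; try apply Rabs_pos; lra.
Qed.

(** * Modulated oscillations *)

(* Written with [b = ln m / 2], so that [(m(0) m)^(-1/2) = exp (- b - b 0)] and [k = K lam]. *)
Lemma modulated_oscillation (b g g1 phi a : R -> R) (lam K D : R) :
  0 < lam ->
  (forall t : R, is_derive b t (g t)) -> (forall t : R, is_derive g t (g1 t)) ->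
  (forall t : R, is_derive phi t (lam * exp (2 * b t))) ->
  (forall t : R, is_derive a t (K * lam * sin (phi t) ^ 2)) ->
  let P t := exp (a t - D * t - b t - b 0) / lam in
  let w t := P t * sin (phi t) in
  let w1 t := P t * ((K * lam * sin (phi t) ^ 2 - g t - D) * sin (phi t)
                     + lam * exp (2 * b t) * cos (phi t)) in
  let d t := exp (2 * b t) ^ 2 + (D / lam) ^ 2
             + (- 2 * K * exp (2 * b t) * sin (2 * phi t)
                - (K * sin (phi t) ^ 2 - g t / lam) ^ 2 + g1 t / lam ^ 2) in
  (forall t : R, is_derive w t (w1 t)) /\
  (forall t : R, is_derive w1 t (- (2 * D) * w1 t - lam ^ 2 * d t * w t)).
Proof.
intros Hlam Hb Hg Hphi Ha P w w1 d; split; intros t; unfold w1, w, d, P.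
- auto_derive.
  + repeat split; eexists; [apply Ha|apply Hb|apply Hphi].
  + rewrite_derive Ha t; rewrite_derive Hb t; rewrite_derive Hphi t.
    unfold Rdiv, Rminus; ring.
- auto_derive.
  + repeat split; (ex_derive_from Ha || ex_derive_from Hb || ex_derive_from Hphi || ex_derive_from Hg || exact I).
  + rewrite_derive Ha t; rewrite_derive Hb t; rewrite_derive Hphi t; rewrite_derive Hg t.
    rewrite sin_2a; unfold Rminus; field; lra.
Qed.

Lemma Rabs_scaled_le (f g B : R) : 0 <= f -> Rabs g <= B -> Rabs (f * g) <= f * B.
Proof.
intros Hf Hg; rewrite Rabs_mult, (Rabs_right f) by lra; apply Rmult_le_compat_l; lra.
Qed.

Lemma sin_sq_bounds (x : R) : 0 <= sin x ^ 2 <= 1.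
Proof. assert (H := sin2_cos2 x); unfold Rsqr in H; nra. Qed.

Lemma Rabs_sin_le (x : R) : Rabs (sin x) <= 1.
Proof. apply Rabs_le, SIN_bound. Qed.

Lemma Rabs_cos_le (x : R) : Rabs (cos x) <= 1.
Proof. apply Rabs_le, COS_bound. Qed.

Lemma Rabs_mult_le (f g A B : R) : Rabs f <= A -> Rabs g <= B -> Rabs (f * g) <= A * B.
Proof. intros; rewrite Rabs_mult; apply Rmult_le_compat; auto using Rabs_pos. Qed.

Lemma Rabs_plus_le (f g A B : R) : Rabs f <= A -> Rabs g <= B -> Rabs (f + g) <= A + B.
Proof. intros; eapply Rle_trans; [apply Rabs_triang|]; lra. Qed.

Lemma Rabs_minus_le (f g A B : R) : Rabs f <= A -> Rabs g <= B -> Rabs (f - g) <= A + B.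
Proof. intros; apply Rabs_plus_le; [|rewrite Rabs_Ropp]; auto. Qed.

Lemma Rabs_sq_le (f A : R) : Rabs f <= A -> Rabs (f ^ 2) <= A ^ 2.
Proof. intros; simpl; rewrite !Rmult_1_r; apply Rabs_mult_le; auto. Qed.

Lemma Rabs_nonneg_le (f : R) : 0 <= f -> Rabs f <= f.
Proof. intros; rewrite Rabs_right; lra. Qed.

Lemma perturbation_bounds (b g g1 g2 phi : R -> R) (lam kap x beta G : R) :
  0 < lam -> / lam <= x -> 0 < kap -> 0 < beta ->
  (forall t : R, is_derive b t (g t)) -> (forall t : R, is_derive g t (g1 t)) ->
  (forall t : R, is_derive g1 t (g2 t)) ->
  (forall t : R, is_derive phi t (lam * exp (2 * b t))) ->
  (forall t, exp (2 * b t) <= beta) ->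
  (forall t, Rabs (g t) <= G) -> (forall t, Rabs (g1 t) <= G) -> (forall t, Rabs (g2 t) <= G) ->
  ((kap + G) ^ 2 + G) * x <= 2 * kap * beta ->
  (4 * kap * beta * G + 2 * (kap + G) * (kap * beta + G) + G) * x <= 4 * kap * beta ^ 2 ->
  x <= 1 ->
  let N t := - 2 * (kap * x) * exp (2 * b t) * sin (2 * phi t)
             - (kap * x * sin (phi t) ^ 2 - g t / lam) ^ 2 + g1 t / lam ^ 2 in
  (forall t, Rabs (N t) <= 4 * kap * beta * x) /\
  (forall t s, Rabs (N t - N s) <= 8 * kap * beta ^ 2 * lam * x * Rabs (t - s)).
Proof.
intros Hlam Hx Hkap Hbeta Db Dg Dg1 Dphi Hm Hg Hg1 Hg2 S1 S2 Hx1 N.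
assert (Hil : 0 < / lam) by (apply Rinv_0_lt_compat; lra).
assert (HG : 0 <= G) by (eapply Rle_trans; [apply Rabs_pos|apply (Hg 0)]).
assert (Hkx : 0 < kap * x) by (apply Rmult_lt_0_compat; lra).
assert (Hlx : 1 <= lam * x).
{ replace 1 with (lam * / lam) by (field; lra); apply Rmult_le_compat_l; lra. }
assert (Bm : forall t, Rabs (exp (2 * b t)) <= beta).
{ intros t; rewrite Rabs_right; [apply Hm|apply Rle_ge, Rlt_le, exp_pos]. }
assert (Bil : Rabs (/ lam) <= x) by (rewrite Rabs_right; lra).
assert (Br : forall t, Rabs (kap * x * sin (phi t) ^ 2 - g t / lam) <= kap * x * 1 + G * x).
{ intros t; apply Rabs_minus_le; apply Rabs_mult_le; auto.
  - apply Rabs_nonneg_le; lra.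
  - rewrite Rabs_right; [apply sin_sq_bounds|apply Rle_ge, sin_sq_bounds]. }
assert (B2 : forall f, Rabs f <= G -> Rabs (f / lam ^ 2) <= G * x ^ 2).
{ intros f Hf; unfold Rdiv; rewrite <- pow_inv; apply Rabs_mult_le; [exact Hf|].
  apply Rabs_sq_le, Bil. }
split.
- intros t; apply Rle_trans with (2 * (kap * x) * beta * 1 + (kap * x * 1 + G * x) ^ 2 + G * x ^ 2).
  + apply Rabs_plus_le; [|apply B2; auto].
    apply Rabs_minus_le; [|apply Rabs_sq_le; auto].
    apply Rabs_mult_le; [|apply Rabs_sin_le]; apply Rabs_mult_le; [|auto].
    rewrite Rabs_left; lra.
  + replace (2 * (kap * x) * beta * 1 + (kap * x * 1 + G * x) ^ 2 + G * x ^ 2)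
      with (x * (2 * kap * beta + ((kap + G) ^ 2 + G) * x)) by ring.
    replace (4 * kap * beta * x) with (x * (4 * kap * beta)) by ring.
    apply Rmult_le_compat_l; lra.
- intros t s.
  destruct (MVT_everywhere N (fun t =>
    - 2 * (kap * x) * exp (2 * b t) * (2 * g t) * sin (2 * phi t)
    - 4 * (kap * x) * lam * exp (2 * b t) ^ 2 * cos (2 * phi t)
    - 2 * (kap * x * sin (phi t) ^ 2 - g t / lam)
      * (kap * x * lam * exp (2 * b t) * (2 * sin (phi t) * cos (phi t)) - g1 t / lam)
    + g2 t / lam ^ 2) s t) as [u [_ E]].
  + intros u; unfold N; auto_derive.
    * repeat split; (ex_derive_from Db || ex_derive_from Dphi || ex_derive_from Dg || ex_derive_from Dg1 || exact I).
    * rewrite_derive Db u; rewrite_derive Dphi u; rewrite_derive Dg u; rewrite_derive Dg1 u.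
      unfold Rminus; field; lra.
  + rewrite E; apply Rabs_mult_le; [|apply Rle_refl].
    rewrite <- sin_2a.
    apply Rle_trans with (2 * (kap * x) * beta * (2 * G) * 1
       + 4 * (kap * x) * lam * beta ^ 2 * 1
       + 2 * (kap * x * 1 + G * x) * (kap * x * lam * beta * 1 + G * x) + G * x ^ 2).
    * assert (0 < kap * x * lam) by (apply Rmult_lt_0_compat; lra).
      apply Rabs_plus_le; [|apply B2; auto].
      apply Rabs_minus_le; [apply Rabs_minus_le|].
      -- apply Rabs_mult_le; [|apply Rabs_sin_le].
         apply Rabs_mult_le; [apply Rabs_mult_le; [|auto]|].
         ++ rewrite Rabs_left; lra.
         ++ apply Rabs_scaled_le; [lra|auto].
      -- apply Rabs_mult_le; [|apply Rabs_cos_le].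
         apply Rabs_mult_le; [|apply Rabs_sq_le; auto].
         apply Rabs_nonneg_le; lra.
      -- apply Rabs_mult_le; [apply Rabs_scaled_le; [lra|auto]|].
         apply Rabs_minus_le; [|apply Rabs_mult_le; auto].
         apply Rabs_mult_le; [|apply Rabs_sin_le].
         apply Rabs_mult_le; [|auto]; apply Rabs_nonneg_le; lra.
    * assert (P1 : 0 <= 4 * kap * beta * G * x * (lam * x - 1))
        by (repeat apply Rmult_le_pos; lra).
      assert (P2 : 0 <= 2 * (kap + G) * x * G * (lam * x - x))
        by (repeat apply Rmult_le_pos; lra).
      assert (P3 : 0 <= G * x * (lam * x - x)) by (repeat apply Rmult_le_pos; lra).
      apply Rle_trans with (lam * x * (4 * kap * beta ^ 2
         + (4 * kap * beta * G + 2 * (kap + G) * (kap * beta + G) + G) * x)); [lra|].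
      replace (8 * kap * beta ^ 2 * lam * x) with (lam * x * (8 * kap * beta ^ 2)) by ring.
      apply Rmult_le_compat_l; lra.
Qed.

Lemma Rmin_1_le_Rpower (y alpha : R) : 0 < y -> 0 < alpha < 1 -> Rmin 1 y <= Rpower y alpha.
Proof.
intros Hy Ha; destruct (Rle_dec 1 y) as [H|H].
- rewrite Rmin_left, <- (Rpower_O y) by lra; apply Rle_Rpower; lra.
- rewrite Rmin_right by lra; rewrite <- (Rpower_1 y) at 1 by lra.
  unfold Rpower; apply Rlt_le, exp_increasing.
  assert (ln y < 0) by (rewrite <- ln_1; apply ln_increasing; lra); nra.
Qed.

(* Interpolation between the sup bound and the Lipschitz bound. *)
Lemma perturbation_holder (N : R -> R) (A beta lam alpha : R) :
  0 < A -> 0 < beta -> 0 < lam -> 0 < alpha < 1 ->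
  (forall t, Rabs (N t) <= A / 2) ->
  (forall t s, Rabs (N t - N s) <= A * (beta * lam) * Rabs (t - s)) ->
  forall t s, t <> s ->
    Rabs (N t - N s) <= A * Rpower beta alpha * Rpower lam alpha * Rpower (Rabs (t - s)) alpha.
Proof.
intros HA Hb Hl Ha HB HL t s Hts.
assert (Hd : 0 < Rabs (t - s)) by (apply Rabs_pos_lt; lra).
assert (Hbl : 0 < beta * lam) by (apply Rmult_lt_0_compat; lra).
apply Rle_trans with (A * Rmin 1 (beta * lam * Rabs (t - s))).
- unfold Rmin; destruct (Rle_dec _ _).
  + replace (A * 1) with (A / 2 + A / 2) by field; apply Rabs_minus_le; auto.
  + rewrite <- Rmult_assoc; apply HL.
- replace (A * Rpower beta alpha * Rpower lam alpha * Rpower (Rabs (t - s)) alpha)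
    with (A * Rpower (beta * lam * Rabs (t - s)) alpha).
  + apply Rmult_le_compat_l; [lra|].
    apply Rmin_1_le_Rpower; [apply Rmult_lt_0_compat|]; auto.
  + rewrite <- !Rpower_mult_distr by auto; ring.
Qed.

(** * Growth of the energy and stability *)

Lemma smooth3_quarter_log (M M1 M2 M3 : R -> R) (m0 : R) :
  smooth3 M M1 M2 M3 -> 0 < m0 -> (forall t, m0 <= M t) ->
  exists b g g1 g2 : R -> R, smooth3 b g g1 g2 /\ forall t, exp (2 * b t) ^ 2 = M t.
Proof.
intros [D [D1 [D2 [B1 [B2 B3]]]]] Hm HM.
assert (Bi := bdd_inv M m0 Hm HM).
exists (fun t => ln (M t) / 4), (fun t => M1 t * / M t * / 4),
  (fun t => (M2 t * / M t - (M1 t * / M t) * (M1 t * / M t)) * / 4),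
  (fun t => (M3 t * / M t - 3 * ((M2 t * / M t) * (M1 t * / M t))
             + 2 * ((M1 t * / M t) * ((M1 t * / M t) * (M1 t * / M t)))) * / 4).
split; [split; [|split; [|split; [|split; [|split]]]]|].
- intros t; specialize (HM t); auto_derive.
  + repeat split; [ex_derive_from D|lra].
  + rewrite_derive D t; field; lra.
- intros t; specialize (HM t); auto_derive.
  + repeat split; (ex_derive_from D || ex_derive_from D1 || lra).
  + rewrite_derive D t; rewrite_derive D1 t; field; lra.
- intros t; specialize (HM t); auto_derive.
  + repeat split; (ex_derive_from D || ex_derive_from D1 || ex_derive_from D2 || lra).
  + rewrite_derive D t; rewrite_derive D1 t; rewrite_derive D2 t; field; lra.
- apply bdd_mult; [|apply bdd_const]; apply bdd_mult; auto.
- apply bdd_mult; [|apply bdd_const]; apply bdd_minus; repeat apply bdd_mult; auto.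
- apply bdd_mult; [|apply bdd_const]; apply bdd_plus; [apply bdd_minus|].
  + apply bdd_mult; auto.
  + apply (bdd_mult (fun _ => 3)); [apply bdd_const|]; repeat apply bdd_mult; auto.
  + apply (bdd_mult (fun _ => 2)); [apply bdd_const|]; repeat apply bdd_mult; auto.
- intros t; specialize (HM t).
  replace (exp (2 * (ln (M t) / 4)) ^ 2) with (exp (ln (M t))).
  + apply exp_ln; lra.
  + simpl; rewrite Rmult_1_r, <- exp_plus; f_equal; field.
Qed.

Lemma exp_nondecreasing (x y : R) : x <= y -> exp x <= exp y.
Proof. intros [H| ->]; [apply Rlt_le, exp_increasing|apply Rle_refl]; auto. Qed.

(* The oscillating part of [2 a' = K lam (1 - cos (2 phi))] is integrated by parts. *)
Lemma exponent_growth (b g phi a : R -> R) (lam K A G : R) :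
  0 < K ->
  (forall t : R, is_derive b t (g t)) ->
  (forall t : R, is_derive phi t (lam * exp (2 * b t))) ->
  (forall t : R, is_derive a t (K * lam * sin (phi t) ^ 2)) ->
  phi 0 = 0 -> a 0 = 0 ->
  (forall t, exp (- 2 * b t) <= A) -> (forall t, Rabs (g t) <= G) ->
  forall t, 0 <= t -> - K * (A / 2 + G * A * t) <= 2 * a t - K * lam * t.
Proof.
intros HK Db Dphi Da P0 A0 HA HG t Ht.
assert (Bm : forall t, Rabs (exp (- 2 * b t)) <= A).
{ intros u; rewrite Rabs_right; [apply HA|apply Rle_ge, Rlt_le, exp_pos]. }
destruct (MVT_everywhere
   (fun t => 2 * a t - K * lam * t + K / 2 * (exp (- 2 * b t) * sin (2 * phi t)))
   (fun t => K * (g t * exp (- 2 * b t) * - sin (2 * phi t))) 0 t) as [u [_ E]].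
- intros u; auto_derive.
  + repeat split; (ex_derive_from Da || ex_derive_from Db || ex_derive_from Dphi).
  + rewrite_derive Da u; rewrite_derive Db u; rewrite_derive Dphi u.
    assert (E1 : exp (- 2 * b u) * exp (2 * b u) = 1).
    { rewrite <- exp_plus, <- exp_0; f_equal; ring. }
    rewrite (cos_2a_sin (phi u)).
    apply Rminus_diag_uniq; match goal with |- ?l = 0 => replace l with
      (K * lam * (1 - 2 * sin (phi u) * sin (phi u)) * (exp (- 2 * b u) * exp (2 * b u) - 1))
      by field end.
    rewrite E1; ring.
- rewrite P0, A0, !Rmult_0_r, sin_0 in E.
  assert (B1 := Rabs_mult_le _ _ _ _ (Bm t) (Rabs_sin_le (2 * phi t))).
  assert (B2 : Rabs (g u * exp (- 2 * b u) * - sin (2 * phi u)) <= G * A * 1).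
  { apply Rabs_mult_le; [apply Rabs_mult_le; auto|]; rewrite Rabs_Ropp; apply Rabs_sin_le. }
  apply Rabs_le_between in B1; apply Rabs_le_between in B2.
  assert (K / 2 * (exp (- 2 * b t) * sin (2 * phi t)) <= K / 2 * (A * 1))
    by (apply Rmult_le_compat_l; lra).
  assert (K * t * - (G * A * 1) <= K * t * (g u * exp (- 2 * b u) * - sin (2 * phi u)))
    by (apply Rmult_le_compat_l; [apply Rmult_le_pos|]; lra).
  lra.
Qed.

(* Here [eps] is the logarithmic derivative of the amplitude divided by [lam]. *)
Lemma oscillator_energy_lower (m eps phi mu1 : R) :
  mu1 <= m ^ 2 -> eps ^ 2 <= 1 / 12 ->
  3 / 4 * Rmin 1 mu1 <= (eps * sin phi + m * cos phi) ^ 2 + sin phi ^ 2.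
Proof.
intros Hm He; assert (Hsc := sin2_cos2 phi); unfold Rsqr in Hsc.
set (s := sin phi) in *; set (c := cos phi) in *.
assert (H1 := Rmin_l 1 mu1); assert (H2 := Rmin_r 1 mu1); set (r := Rmin 1 mu1) in *.
assert (r * c ^ 2 <= m ^ 2 * c ^ 2) by (apply Rmult_le_compat_r; [apply pow2_ge_0|lra]).
assert (r * s ^ 2 <= 1 * s ^ 2) by (apply Rmult_le_compat_r; [apply pow2_ge_0|lra]).
assert (eps ^ 2 * s ^ 2 <= 1 / 12 * s ^ 2) by (apply Rmult_le_compat_r; [apply pow2_ge_0|lra]).
assert (0 <= (m * c / 2 + 2 * (eps * s)) ^ 2) by apply pow2_ge_0.
replace (3 / 4 * r) with (3 / 4 * r * (s * s + c * c)) by (rewrite Hsc; ring).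
nra.
Qed.

Lemma weighted_energy_lower (a b b0 phi rho m lam D k t mu1 mu2 : R) :
  0 < lam -> 0 < mu1 -> 0 < mu2 -> m = exp (2 * b) ->
  mu1 <= m ^ 2 <= mu2 -> exp (2 * b0) ^ 2 <= mu2 ->
  - (1 / 6) <= 2 * a - k * t -> (rho / lam) ^ 2 <= 1 / 12 ->
  let P := exp (a - D * t - b - b0) / lam in
  5 / 8 * (Rmin 1 mu1 / mu2) <=
  ((P * (rho * sin phi + lam * m * cos phi)) ^ 2 + lam ^ 2 * (P * sin phi) ^ 2)
   * exp (- k * t + 2 * D * t).
Proof.
intros Hlam Hmu1 Hmu2 Em [Hm1 Hm2] Hm0 Ha Hr P.
assert (Ho := oscillator_energy_lower m (rho / lam) phi mu1 Hm1 Hr).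
assert (Hq : 0 < Rmin 1 mu1) by (apply Rmin_case; lra).
assert (Eq : ((P * (rho * sin phi + lam * m * cos phi)) ^ 2 + lam ^ 2 * (P * sin phi) ^ 2)
   * exp (- k * t + 2 * D * t) =
   exp (2 * a - k * t) * / (m * exp (2 * b0)) *
   ((rho / lam * sin phi + m * cos phi) ^ 2 + sin phi ^ 2)).
{ replace (exp (2 * a - k * t) * / (m * exp (2 * b0))) with
    (exp (a - D * t - b - b0) ^ 2 * exp (- k * t + 2 * D * t)).
  - unfold P; field; lra.
  - rewrite Em, <- exp_plus, <- exp_Ropp; simpl; rewrite Rmult_1_r, <- !exp_plus.
    f_equal; ring. }
rewrite Eq.
assert (Hmp : 0 < m) by (rewrite Em; apply exp_pos).
assert (Hm0p := exp_pos (2 * b0)).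
assert (Hmm : m * exp (2 * b0) <= mu2).
{ assert (0 <= (m - exp (2 * b0)) ^ 2) by apply pow2_ge_0; nra. }
assert (Hmmp : 0 < m * exp (2 * b0)) by (apply Rmult_lt_0_compat; lra).
assert (E1 : 5 / 6 <= exp (2 * a - k * t)).
{ assert (H := exp_ineq1_le (2 * a - k * t)); lra. }
assert (E2 : / mu2 <= / (m * exp (2 * b0))) by (apply Rinv_le_contravar; lra).
assert (E3 : 0 < / mu2) by (apply Rinv_0_lt_compat; lra).
replace (5 / 8 * (Rmin 1 mu1 / mu2)) with (5 / 6 * / mu2 * (3 / 4 * Rmin 1 mu1))
  by (field; lra).
apply Rmult_le_compat; [nra|lra| |exact Ho].
apply Rmult_le_compat; lra.
Qed.

Lemma gronwall_stability (u u1 v v1 d e : R -> R) (lam D T mu W r : R) :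
  0 < lam -> 0 <= D -> 0 <= T -> 0 <= mu -> 0 <= r ->
  (forall t, 0 <= t -> is_derive u t (u1 t)) ->
  (forall t, 0 <= t -> is_derive u1 t (- (2 * D) * u1 t - lam ^ 2 * d t * u t)) ->
  (forall t, 0 <= t -> is_derive v t (v1 t)) ->
  (forall t, 0 <= t -> is_derive v1 t (- (2 * D) * v1 t - lam ^ 2 * e t * v t)) ->
  u 0 = v 0 -> u1 0 = v1 0 ->
  (forall t, 0 <= t <= T -> Rabs (e t) <= mu) ->
  (forall t, 0 <= t <= T -> Rabs (u t) <= W) ->
  (forall t, 0 <= t <= T -> Rabs (d t - e t) <= r) ->
  forall t, 0 <= t <= T ->
    (v t - u t) ^ 2 + (v1 t - u1 t) ^ 2 <=
    r ^ 2 * (exp ((lam ^ 2 * mu + 2) * T) * (lam ^ 2 * W) ^ 2 * T).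
Proof.
intros Hlam HD HT Hmu Hr Du Du1 Dv Dv1 E0 E1 He Hu Hde t Ht.
set (K := lam ^ 2 * mu + 2).
assert (HW : 0 <= W) by (eapply Rle_trans; [apply Rabs_pos|apply (Hu 0); lra]).
set (Q := (lam ^ 2 * (r * W)) ^ 2).
assert (HQ : 0 <= Q) by apply pow2_ge_0.
assert (HK : 0 <= K).
{ assert (0 <= lam ^ 2 * mu) by (apply Rmult_le_pos; [apply pow2_ge_0|lra]); unfold K; lra. }
set (y := fun t => v t - u t); set (y1 := fun t => v1 t - u1 t).
set (G := fun t => y t ^ 2 + y1 t ^ 2).
set (G1 := fun t => 2 * y t * y1 t
   + 2 * y1 t * (- (2 * D) * y1 t - lam ^ 2 * (e t * y t) + lam ^ 2 * ((d t - e t) * u t))).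
assert (DG : forall t, 0 <= t -> is_derive G t (G1 t)).
{ intros s Hs; unfold G, y, y1; specialize (Du s Hs); specialize (Du1 s Hs);
  specialize (Dv s Hs); specialize (Dv1 s Hs); auto_derive.
  - repeat split; eexists; eassumption.
  - change (Derive (fun x => v x) s) with (Derive v s).
    change (Derive (fun x => u x) s) with (Derive u s).
    change (Derive (fun x => v1 x) s) with (Derive v1 s).
    change (Derive (fun x => u1 x) s) with (Derive u1 s).
    rewrite (is_derive_unique _ _ _ Du), (is_derive_unique _ _ _ Du1),
      (is_derive_unique _ _ _ Dv), (is_derive_unique _ _ _ Dv1).
    unfold G1, y, y1; ring. }
assert (BG : forall t, 0 <= t <= T -> G1 t <= K * G t + Q).
{ intros s Hs; unfold G1, G; set (Y := y s); set (Z := y1 s).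
  assert (I1 : Rabs (e s * Y) <= mu * Rabs Y)
    by (apply Rabs_mult_le; [auto|apply Rle_refl]).
  assert (I2 : Rabs ((d s - e s) * u s) <= r * W) by (apply Rabs_mult_le; auto).
  assert (I3 : Rabs (2 * Z * (e s * Y)) <= mu * (Y ^ 2 + Z ^ 2)).
  { apply Rle_trans with (2 * Rabs Z * (mu * Rabs Y)).
    - apply Rabs_mult_le; [|auto]; rewrite Rabs_mult, (Rabs_right 2); lra.
    - rewrite <- (pow2_abs Y), <- (pow2_abs Z).
      assert (0 <= mu * (Rabs Y - Rabs Z) ^ 2) by (apply Rmult_le_pos; [lra|apply pow2_ge_0]); lra. }
  apply Rabs_le_between in I3.
  set (p := (d s - e s) * u s) in *; set (q := e s * Y) in *.
  assert (I4 : (lam ^ 2 * p) ^ 2 <= Q).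
  { unfold Q; apply pow_maj_Rabs; rewrite Rabs_mult, (Rabs_right (lam ^ 2)).
    - apply Rmult_le_compat_l; [apply pow2_ge_0|auto].
    - apply Rle_ge, pow2_ge_0. }
  assert (lam ^ 2 * - (2 * Z * q) <= lam ^ 2 * (mu * (Y ^ 2 + Z ^ 2)))
    by (apply Rmult_le_compat_l; [apply pow2_ge_0|lra]).
  assert (0 <= (Z - lam ^ 2 * p) ^ 2) by apply pow2_ge_0.
  assert (0 <= (Y - Z) ^ 2) by apply pow2_ge_0.
  assert (0 <= D * Z ^ 2) by (apply Rmult_le_pos; [lra|apply pow2_ge_0]).
  unfold K; nra. }
assert (Hdec : G t * exp (- K * t) - Q * t <= 0).
{ destruct (MVT_gen (fun t => G t * exp (- K * t) - Q * t) 0 t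
     (fun t => (G1 t - K * G t) * exp (- K * t) - Q)) as [x [Hx Ex]].
  - rewrite Rmin_left, Rmax_right by lra; intros x Hx.
    assert (Dx := DG x ltac:(lra)); auto_derive.
    + repeat split; eexists; eassumption.
    + change (Derive (fun x => G x) x) with (Derive G x).
      rewrite (is_derive_unique _ _ _ Dx); ring.
  - rewrite Rmin_left, Rmax_right by lra; intros x Hx.
    assert (Dx := DG x ltac:(lra)).
    apply derivable_continuous_pt, ex_derive_Reals_0; auto_derive.
    repeat split; eexists; eassumption.
  - rewrite Rmin_left, Rmax_right in Hx by lra.
    assert (G00 : G 0 = 0) by (unfold G, y, y1; rewrite E0, E1; ring).
    rewrite G00 in Ex.
    assert (BGx := BG x ltac:(lra)).
    assert (Hex : exp (- K * x) <= 1).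
    { rewrite <- exp_0; apply exp_nondecreasing; assert (0 <= K * x) by (apply Rmult_le_pos; lra); lra. }
    assert (Hep := exp_pos (- K * x)).
    assert ((G1 x - K * G x) * exp (- K * x) <= Q * exp (- K * x))
      by (apply Rmult_le_compat_r; lra).
    assert (Q * exp (- K * x) <= Q * 1) by (apply Rmult_le_compat_l; lra).
    assert (0 <= (Q - (G1 x - K * G x) * exp (- K * x)) * t) by (apply Rmult_le_pos; lra).
    lra. }
change (G t <= r ^ 2 * (exp (K * T) * (lam ^ 2 * W) ^ 2 * T)).
replace (G t) with (exp (K * t) * (G t * exp (- K * t))).
- apply Rle_trans with (exp (K * t) * (Q * t)).
  + apply Rmult_le_compat_l; [apply Rlt_le, exp_pos|lra].
  + replace (r ^ 2 * (exp (K * T) * (lam ^ 2 * W) ^ 2 * T)) with (exp (K * T) * (Q * T))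
      by (unfold Q; ring).
    assert (0 <= Q * t) by (apply Rmult_le_pos; lra).
    apply Rmult_le_compat; [apply Rlt_le, exp_pos|lra| |].
    * apply exp_nondecreasing, Rmult_le_compat_l; lra.
    * apply Rmult_le_compat_l; lra.
- rewrite (Rmult_comm (G t)), <- Rmult_assoc, <- exp_plus.
  replace (K * t + - K * t) with 0 by ring; rewrite exp_0; ring.
Qed.

Lemma deriv_nonneg_extension (f f' : R -> R) :
  deriv_nonneg f f' ->
  forall t, 0 <= t ->
    is_derive (fun t => if Rle_dec 0 t then f t else f 0 + f' 0 * t) t (f' t).
Proof.
intros Hf t Ht; apply is_derive_Reals; intros eps Heps.
destruct (Hf t Ht eps Heps) as [del [Hdel Hq]].
pose (del' := if Rlt_dec 0 t then Rmin del t else del).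
assert (Hdel' : 0 < del').
{ unfold del'; destruct (Rlt_dec 0 t); [apply Rmin_case|]; auto. }
assert (Hle : del' <= del).
{ unfold del'; destruct (Rlt_dec 0 t); [apply Rmin_l|lra]. }
exists (mkposreal del' Hdel'); simpl; intros h Hh Hhd.
destruct (Rle_dec 0 t) as [_|]; [|lra].
destruct (Rle_dec 0 (t + h)) as [Hth|Hth]; [apply Hq; lra|].
assert (E : t = 0).
{ unfold del' in Hhd; destruct (Rlt_dec 0 t); [|lra].
  assert (Hm := Rmin_r del t); apply Rabs_def2 in Hhd; lra. }
subst t; replace ((f 0 + f' 0 * (0 + h) - f 0) / h - f' 0) with 0 by (field; auto).
rewrite Rabs_R0; exact Heps.
Qed.

Lemma scaled_small (C c : R) :
  0 < c -> exists eps, 0 < eps /\ forall x, 0 <= x <= eps -> C * x <= c.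
Proof.
intros Hc; exists (c / (Rabs C + 1)).
assert (HC := Rabs_pos C); assert (HC' := Rle_abs C); split; [apply Rdiv_lt_0_compat; lra|].
intros x [Hx Hxe]; apply Rle_trans with ((Rabs C + 1) * x).
- apply Rmult_le_compat_r; lra.
- replace c with ((Rabs C + 1) * (c / (Rabs C + 1))) by (field; lra).
  apply Rmult_le_compat_l; lra.
Qed.

Lemma square_sum_lower (a v : R) : 9 / 10 * a ^ 2 - 9 * v ^ 2 <= (a + v) ^ 2.
Proof. assert (0 <= (a + 10 * v) ^ 2) by apply pow2_ge_0; nra. Qed.

Lemma energy_lower_robust (u u1 d : R -> R) (lam delta sigma k T mu Q q : R) :
  0 < lam -> 0 <= delta -> 0 <= k -> 0 <= T -> 0 <= mu -> q < 9 / 10 * Q ->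
  let D := delta * Rpower lam (2 * sigma) in
  (forall t : R, is_derive u t (u1 t)) ->
  (forall t : R, is_derive u1 t (- (2 * D) * u1 t - lam ^ 2 * d t * u t)) ->
  u 0 = 0 -> u1 0 = 1 ->
  (forall t, 0 <= t <= T -> Q <= (u1 t ^ 2 + lam ^ 2 * u t ^ 2) * exp (- k * t + 2 * D * t)) ->
  exists r, 0 < r /\ forall e,
    (forall t, 0 <= t -> 0 <= e t <= mu) -> udist_lt d e r ->
    forall w w', is_solution delta sigma lam e w w' ->
    forall t, 0 <= t <= T ->
      q < (Rabs (w' t) ^ 2 + lam ^ 2 * Rabs (w t) ^ 2) * exp (- k * t + 2 * D * t).
Proof.
intros Hlam Hdelta Hk HT Hmu HqQ D Du Du1 U0 U1 HQ.
assert (HD : 0 <= D) by (apply Rmult_le_pos; [lra|apply Rlt_le, exp_pos]).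
assert (Hbound : exists W, forall t, 0 <= t <= T -> Rabs (u t) <= W).
{ destruct (continuity_ab_maj (fun t => Rabs (u t)) 0 T HT) as [x [Hx _]].
  - intros c _; apply (continuity_pt_comp u Rabs); [|apply Rcontinuity_abs].
    apply derivable_continuous_pt; exists (u1 c); apply is_derive_Reals, Du.
  - exists (Rabs (u x)); exact Hx. }
destruct Hbound as [W HW].
set (C0 := exp ((lam ^ 2 * mu + 2) * T) * (lam ^ 2 * W) ^ 2 * T).
set (C1 := 9 * ((1 + lam ^ 2) * exp (2 * D * T))).
destruct (scaled_small (C1 * C0) ((9 / 10 * Q - q) / 2)) as [eps [Heps Hsm]]; [lra|].
exists (Rmin 1 eps); split; [apply Rmin_case; lra|].
intros e He [r [Hr Hde]] w w' [Hw [Hw' [W0 W1]]] t Ht.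
assert (Hr0 : 0 <= r) by (eapply Rle_trans; [apply Rabs_pos|apply (Hde 0); lra]).
assert (Hr1 := Rmin_l 1 eps); assert (Hr2 := Rmin_r 1 eps).
set (ext := fun (f f' : R -> R) (t : R) => if Rle_dec 0 t then f t else f 0 + f' 0 * t).
assert (Eext : forall f f' t, 0 <= t -> ext f f' t = f t).
{ intros f f' s Hs; unfold ext; destruct (Rle_dec 0 s); [reflexivity|lra]. }
set (w'' := fun t => - (2 * delta * Rpower lam (2 * sigma)) * w' t - lam ^ 2 * e t * w t).
assert (Gr := gronwall_stability u u1 (ext w w') (ext w' w'') d e lam D T mu W r
  Hlam HD HT Hmu Hr0).
specialize (Gr ltac:(auto) ltac:(auto)).
assert (G : (w t - u t) ^ 2 + (w' t - u1 t) ^ 2 <= r ^ 2 * C0).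
{ assert (Ht0 : 0 <= t) by lra; assert (H0 : 0 <= 0) by lra.
  rewrite <- (Eext w w' t Ht0), <- (Eext w' w'' t Ht0); apply Gr; auto.
  - intros s Hs; rewrite (Eext w' w'' s Hs); exact (deriv_nonneg_extension _ _ Hw s Hs).
  - intros s Hs; rewrite (Eext w' w'' s Hs), (Eext w w' s Hs).
    replace (- (2 * D) * w' s - lam ^ 2 * e s * w s) with (w'' s) by (unfold w'', D; ring).
    exact (deriv_nonneg_extension _ _ Hw' s Hs).
  - rewrite (Eext _ _ 0 H0); congruence.
  - rewrite (Eext _ _ 0 H0); congruence.
  - intros s [Hs _]; specialize (He s Hs); rewrite Rabs_right; lra.
  - intros s [Hs _]; auto. }
rewrite !pow2_abs.
assert (HC0 : 0 <= C0).
{ unfold C0; apply Rmult_le_pos; [apply Rmult_le_pos|lra].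
  - apply Rlt_le, exp_pos.
  - apply pow2_ge_0. }
assert (HC1 : 0 <= C1).
{ unfold C1; assert (H1 := exp_pos (2 * D * T)); assert (0 <= lam ^ 2) by apply pow2_ge_0.
  repeat apply Rmult_le_pos; lra. }
specialize (HQ t Ht); set (X := exp (- k * t + 2 * D * t)) in *.
assert (HX : 0 < X) by apply exp_pos.
assert (HX2 : X <= exp (2 * D * T)).
{ apply exp_nondecreasing; assert (0 <= k * t) by (apply Rmult_le_pos; lra).
  assert (D * t <= D * T) by (apply Rmult_le_compat_l; lra); lra. }
set (y := w t - u t) in *; set (y1 := w' t - u1 t) in *.
assert (S1 := square_sum_lower (u1 t) y1); assert (S2 := square_sum_lower (u t) y).
replace (u1 t + y1) with (w' t) in S1 by (unfold y1; ring).
replace (u t + y) with (w t) in S2 by (unfold y; ring).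
assert (Hl2 : 0 <= lam ^ 2) by apply pow2_ge_0.
assert (Hy := pow2_ge_0 y); assert (Hy1 := pow2_ge_0 y1).
assert (S3 : lam ^ 2 * (9 / 10 * u t ^ 2 - 9 * y ^ 2) <= lam ^ 2 * w t ^ 2)
  by (apply Rmult_le_compat_l; lra).
assert (S4 : y1 ^ 2 + lam ^ 2 * y ^ 2 <= (1 + lam ^ 2) * (r ^ 2 * C0)).
{ apply Rle_trans with ((1 + lam ^ 2) * (y ^ 2 + y1 ^ 2)).
  - assert (0 <= lam ^ 2 * y1 ^ 2) by (apply Rmult_le_pos; lra); lra.
  - apply Rmult_le_compat_l; lra. }
assert (S5 : (9 / 10 * (u1 t ^ 2 + lam ^ 2 * u t ^ 2) - 9 * ((1 + lam ^ 2) * (r ^ 2 * C0))) * X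
   <= (w' t ^ 2 + lam ^ 2 * w t ^ 2) * X) by (apply Rmult_le_compat_r; lra).
assert (Hrr : r ^ 2 <= r) by nra.
assert (S6 : 9 * ((1 + lam ^ 2) * (r ^ 2 * C0)) * X <= C1 * C0 * r).
{ apply Rle_trans with (9 * ((1 + lam ^ 2) * (r ^ 2 * C0)) * exp (2 * D * T)).
  - apply Rmult_le_compat_l; [|exact HX2].
    assert (0 <= (1 + lam ^ 2) * (r ^ 2 * C0)); [|lra].
    apply Rmult_le_pos; [lra|]; apply Rmult_le_pos; [apply pow2_ge_0|lra].
  - replace (9 * ((1 + lam ^ 2) * (r ^ 2 * C0)) * exp (2 * D * T)) with (C1 * C0 * r ^ 2)
      by (unfold C1; ring).
    apply Rmult_le_compat_l; [apply Rmult_le_pos; lra|lra]. }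
assert (S7 := Hsm r ltac:(lra)).
lra.
Qed.

(* The oscillation has small sup norm, so it only matters at small scales, where the
   Lipschitz function [M] is negligible in Hölder norm. *)
Lemma holder_sum (M N : R -> R) (H alpha eta L rho B : R) :
  0 < H -> 0 < alpha < 1 -> 0 < rho -> 0 <= L -> 0 < eta ->
  L * Rpower rho (1 - alpha) <= H / 2 ->
  (forall t s, Rabs (M t - M s) <= L * Rabs (t - s)) ->
  (forall t s, t <> s -> Rabs (M t - M s) <= (1 - eta) * (H * Rpower (Rabs (t - s)) alpha)) ->
  (forall t, Rabs (N t) <= B) -> 2 * B <= eta * (H * Rpower rho alpha) ->
  (forall t s, t <> s -> Rabs (N t - N s) <= H / 2 * Rpower (Rabs (t - s)) alpha) ->
  forall t s, Rabs (M t + N t - (M s + N s)) <= H * Rpower (Rabs (t - s)) alpha.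
Proof.
intros HH Ha Hrho HL Heta Hs ML MH NB HB NH t s.
destruct (Req_dec t s) as [->|Hts].
{ unfold Rminus at 1; rewrite Rplus_opp_r, Rabs_R0.
  apply Rlt_le, Rmult_lt_0_compat; [lra|apply exp_pos]. }
assert (Hd : 0 < Rabs (t - s)) by (apply Rabs_pos_lt; lra).
replace (M t + N t - (M s + N s)) with ((M t - M s) + (N t - N s)) by ring.
set (tau := Rabs (t - s)) in *; set (p := Rpower tau alpha).
assert (Hp : 0 < p) by apply exp_pos.
destruct (Rle_dec tau rho) as [Hle|Hgt].
- replace (H * p) with (H / 2 * p + H / 2 * p) by field.
  apply Rabs_plus_le; [|apply NH; auto].
  eapply Rle_trans; [apply ML|]; fold tau.
  replace tau with (Rpower tau (1 - alpha) * p).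
  + rewrite <- Rmult_assoc; apply Rmult_le_compat_r; [lra|].
    eapply Rle_trans; [|exact Hs]; apply Rmult_le_compat_l; [lra|].
    apply Rle_Rpower_l; lra.
  + unfold p; rewrite <- Rpower_plus; replace (1 - alpha + alpha) with 1 by ring.
    apply Rpower_1; exact Hd.
- replace (H * p) with ((1 - eta) * (H * p) + eta * (H * p)) by ring.
  apply Rabs_plus_le; [apply MH; auto|].
  apply Rle_trans with (B + B); [apply Rabs_minus_le; auto|].
  apply Rle_trans with (eta * (H * Rpower rho alpha)); [lra|].
  apply Rmult_le_compat_l; [lra|]; apply Rmult_le_compat_l; [lra|].
  apply Rle_Rpower_l; lra.
Qed.

Lemma Rpower_eventually_small (alpha sigma delta eps : R) :
  0 < alpha < 1 -> sigma < 1 / 2 -> 0 <= delta -> 0 < eps ->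
  exists L, forall lam, L < lam ->
    1 <= lam /\ Rpower lam (- alpha) <= eps /\ / lam <= Rpower lam (- alpha) /\
    delta * Rpower lam (2 * sigma) / lam <= eps.
Proof.
intros Ha Hs Hd He.
assert (Hsmall : forall p e, 0 < p -> 0 < e -> forall lam, Rpower e (- / p) < lam -> Rpower lam (- p) <= e).
{ intros p e Hp Hpe lam Hlam.
  assert (Hl : 0 < lam) by (eapply Rlt_trans; [apply exp_pos|exact Hlam]).
  rewrite Rpower_Ropp; replace e with (/ / e) by (field; lra).
  apply Rinv_le_contravar; [apply Rinv_0_lt_compat; lra|].
  replace (/ e) with (Rpower (Rpower e (- / p)) p).
  - apply Rle_Rpower_l; [lra|]; split; [apply exp_pos|lra].
  - rewrite Rpower_mult; replace (- / p * p) with (-(1)) by (field; lra).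
    rewrite Rpower_Ropp, Rpower_1; auto. }
assert (He2 : 0 < eps / (delta + 1)) by (apply Rdiv_lt_0_compat; lra).
exists (Rmax 1 (Rmax (Rpower eps (- / alpha)) (Rpower (eps / (delta + 1)) (- / (1 - 2 * sigma))))).
intros lam Hlam.
assert (H1 := Rmax_l 1 (Rmax (Rpower eps (- / alpha)) (Rpower (eps / (delta + 1)) (- / (1 - 2 * sigma))))).
assert (H2 := Rmax_r 1 (Rmax (Rpower eps (- / alpha)) (Rpower (eps / (delta + 1)) (- / (1 - 2 * sigma))))).
assert (H3 := Rmax_l (Rpower eps (- / alpha)) (Rpower (eps / (delta + 1)) (- / (1 - 2 * sigma)))).
assert (H4 := Rmax_r (Rpower eps (- / alpha)) (Rpower (eps / (delta + 1)) (- / (1 - 2 * sigma)))).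
assert (Hil : / lam = Rpower lam (-(1))) by (rewrite Rpower_Ropp, Rpower_1; lra).
split; [lra|split; [apply Hsmall; lra|split]].
- rewrite Hil; apply Rle_Rpower; lra.
- unfold Rdiv; rewrite Hil, Rmult_assoc, <- Rpower_plus.
  replace (2 * sigma + -(1)) with (- (1 - 2 * sigma)) by ring.
  assert (Hx := Hsmall (1 - 2 * sigma) (eps / (delta + 1)) ltac:(lra) He2 lam ltac:(lra)).
  assert (Hp := exp_pos (- (1 - 2 * sigma) * ln lam)); fold (Rpower lam (- (1 - 2 * sigma))) in Hp.
  apply Rle_trans with ((delta + 1) * (eps / (delta + 1))); [|right; field; lra].
  apply Rmult_le_compat; lra.
Qed.

(** * Density of activating speeds *)

Lemma bdd3_common (f g h : R -> R) :
  bdd f -> bdd g -> bdd h -> exists G, 0 <= G /\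
    (forall t, Rabs (f t) <= G) /\ (forall t, Rabs (g t) <= G) /\ (forall t, Rabs (h t) <= G).
Proof.
intros [A HA] [B HB] [C HC]; exists (Rmax A (Rmax B C)).
assert (H1 := Rmax_l A (Rmax B C)); assert (H2 := Rmax_r A (Rmax B C)).
assert (H3 := Rmax_l B C); assert (H4 := Rmax_r B C).
assert (0 <= A) by (eapply Rle_trans; [apply Rabs_pos|apply (HA 0)]).
split; [lra|]; repeat split; intros t; specialize (HA t); specialize (HB t); specialize (HC t); lra.
Qed.

Lemma phase_exists (b g : R -> R) (lam k : R) :
  (forall t : R, is_derive b t (g t)) ->
  exists phi a : R -> R, phi 0 = 0 /\ a 0 = 0 /\
    (forall t : R, is_derive phi t (lam * exp (2 * b t))) /\
    (forall t : R, is_derive a t (k * sin (phi t) ^ 2)).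
Proof.
intros Db.
destruct (antiderivative_exists (fun t => lam * exp (2 * b t))) as [phi [P0 Dphi]].
{ apply (is_derive_continuous _ (fun t => lam * (exp (2 * b t) * (2 * g t)))); intros t; auto_derive.
  - ex_derive_from Db.
  - rewrite_derive Db t; ring. }
destruct (antiderivative_exists (fun t => k * sin (phi t) ^ 2)) as [a [A0 Da]].
{ apply (is_derive_continuous _
    (fun t => k * (2 * sin (phi t) * (cos (phi t) * (lam * exp (2 * b t)))))); intros t; auto_derive.
  - ex_derive_from Dphi.
  - rewrite_derive Dphi t; ring. }
exists phi, a; auto.
Qed.

Lemma mu3_lt (mu1 mu2 : R) :
  0 < mu1 -> mu1 < mu2 ->
  mu1 * Rmin 1 mu1 / (2 * mu2 ^ 2) < 9 / 10 * (5 / 8 * (Rmin 1 mu1 / mu2)).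
Proof.
intros H1 H2; assert (Hq : 0 < Rmin 1 mu1) by (apply Rmin_case; lra).
replace (mu1 * Rmin 1 mu1 / (2 * mu2 ^ 2)) with (Rmin 1 mu1 / mu2 * (mu1 / mu2 / 2)) by (field; lra).
replace (9 / 10 * (5 / 8 * (Rmin 1 mu1 / mu2))) with (Rmin 1 mu1 / mu2 * (9 / 16)) by (field; lra).
apply Rmult_lt_compat_l; [apply Rdiv_lt_0_compat; lra|].
assert (mu1 / mu2 < 1); [|lra].
apply Rlt_div_l; lra.
Qed.

(* Quantifying over a whole ball of speeds makes the condition open in [c]. *)
Definition activates_near (mu1 mu2 alpha H delta sigma mu3 mu5 T lam : R) (c : R -> R) : Prop :=
  exists r, 0 < r /\ forall e, PS mu1 mu2 alpha H e -> udist_lt c e r ->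
    forall w w', is_solution delta sigma lam e w w' -> forall t, 0 <= t <= T ->
      mu3 < (Rabs (w' t) ^ 2 + lam ^ 2 * Rabs (w t) ^ 2) *
            exp (- mu5 * Rpower lam (1 - alpha) * t + 2 * delta * Rpower lam (2 * sigma) * t).

Lemma activating_speed_near (mu1 mu2 alpha H delta sigma T r : R) (c : R -> R) :
  0 < mu1 -> mu1 < mu2 -> 0 < alpha < 1 -> 0 < H -> 0 <= delta -> 0 < sigma < 1 / 2 ->
  0 <= T -> 0 < r -> PS mu1 mu2 alpha H c ->
  exists L, forall lam, L < lam -> exists d,
    PS mu1 mu2 alpha H d /\ udist_lt c d r /\
    activates_near mu1 mu2 alpha H delta sigma (mu1 * Rmin 1 mu1 / (2 * mu2 ^ 2))
      (H / (16 * Rpower mu2 ((1 + alpha) / 2))) T lam d.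
Proof.
intros Hmu1 Hmu2 Ha HH Hdelta Hsigma HT Hr Hc.
set (kap := H / (16 * Rpower mu2 ((1 + alpha) / 2))).
assert (Hkap : 0 < kap).
{ apply Rdiv_lt_0_compat; [lra|]; apply Rmult_lt_0_compat; [lra|apply exp_pos]. }
destruct (smooth_approximation mu1 mu2 alpha H (r / 4) c)
  as [M [M1 [M2 [M3 [eta [SM [Heta [MB [Mc MH]]]]]]]]]; [lra|lra|lra|lra|lra|exact Hc|].
destruct (smooth3_quarter_log M M1 M2 M3 mu1 SM Hmu1) as [b [g [g1 [g2 [Sb Eb]]]]].
{ intros t; specialize (MB t); lra. }
destruct Sb as [Db [Dg [Dg1 [Bg [Bg1 Bg2]]]]].
destruct (bdd3_common g g1 g2 Bg Bg1 Bg2) as [G [HG [BG [BG1 BG2]]]].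
destruct SM as [DM [_ [_ [[L HL] _]]]].
assert (HL0 : 0 <= L) by (eapply Rle_trans; [apply Rabs_pos|apply (HL 0)]).
set (beta := sqrt mu2); assert (Hbeta : 0 < beta) by (apply sqrt_lt_R0; lra).
assert (Hbeta2 : beta ^ 2 = mu2) by (apply pow2_sqrt; lra).
set (A := / sqrt mu1); assert (Hs1 : 0 < sqrt mu1) by (apply sqrt_lt_R0; lra).
assert (Hs2 : sqrt mu1 ^ 2 = mu1) by (apply pow2_sqrt; lra).
assert (Hm : forall t, sqrt mu1 <= exp (2 * b t) <= beta).
{ intros t; rewrite <- (sqrt_pow2 (exp (2 * b t))) by apply Rlt_le, exp_pos.
  rewrite Eb; specialize (MB t); split; apply sqrt_le_1_alt; lra. }
assert (HA : forall t, exp (- 2 * b t) <= A).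
{ intros t; replace (- 2 * b t) with (- (2 * b t)) by ring; rewrite exp_Ropp.
  apply Rinv_le_contravar; [lra|apply Hm]. }
assert (HA0 : 0 < A) by (apply Rinv_0_lt_compat; lra).
destruct (Rpower_holder_small (L + 1) (1 - alpha) (H / 2)) as [rho [Hrho Hrs]]; [lra..|].
specialize (Hrs rho (conj Hrho (Rle_refl rho))).
assert (Hrp : 0 < Rpower rho alpha) by apply exp_pos.
destruct (scaled_small ((kap + G) ^ 2 + G) (2 * kap * beta)) as [e1 [He1 S1]].
{ apply Rmult_lt_0_compat; lra. }
destruct (scaled_small (4 * kap * beta * G + 2 * (kap + G) * (kap * beta + G) + G)
  (4 * kap * beta ^ 2)) as [e2 [He2 S2]].
{ apply Rmult_lt_0_compat; lra. }
destruct (scaled_small (4 * kap * beta) (Rmin (r / 4) (eta / 2))) as [e3 [He3 S3]].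
{ apply Rmin_case; lra. }
destruct (scaled_small (2 * (4 * kap * beta)) (eta * (H * Rpower rho alpha))) as [e4 [He4 S4]].
{ repeat apply Rmult_lt_0_compat; lra. }
destruct (scaled_small 1 (Rmin 1 (Rmin (eta / 2) (r / 4)))) as [e5 [He5 S5]].
{ apply Rmin_case; [lra|]; apply Rmin_case; lra. }
destruct (scaled_small (kap + G + 1) (1 / 4)) as [e6 [He6 S6]]; [lra|].
destruct (scaled_small (kap * (A / 2 + G * A * T)) (1 / 6)) as [e7 [He7 S7]]; [lra|].
set (eps := Rmin e1 (Rmin e2 (Rmin e3 (Rmin e4 (Rmin e5 (Rmin e6 e7)))))).
assert (Heps : 0 < eps /\ eps <= e1 /\ eps <= e2 /\ eps <= e3 /\ eps <= e4 /\ eps <= e5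
  /\ eps <= e6 /\ eps <= e7).
{ unfold eps; split; [repeat (apply Rmin_case; [assumption|]); assumption|].
  repeat split; repeat first [apply Rmin_l | apply Rmin_r | eapply Rle_trans; [apply Rmin_r|]]. }
destruct Heps as [Heps [L1 [L2 [L3 [L4 [L5 [L6 L7]]]]]]].
destruct (Rpower_eventually_small alpha sigma delta eps Ha ltac:(lra) Hdelta Heps) as [L0 HL'].
exists L0; intros lam Hlam; destruct (HL' lam Hlam) as [Hlam1 [Hxe [Hix Hye]]].
set (x := Rpower lam (- alpha)) in *.
set (D := delta * Rpower lam (2 * sigma)) in *.
set (y := D / lam) in *.
assert (Hx : 0 < x) by apply exp_pos.
assert (Hy : 0 <= y).
{ apply Rdiv_le_0_compat; [|lra]; apply Rmult_le_pos; [lra|apply Rlt_le, exp_pos]. }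
specialize (S1 x ltac:(lra)); specialize (S2 x ltac:(lra)); specialize (S3 x ltac:(lra)).
specialize (S4 x ltac:(lra)); specialize (S7 x ltac:(lra)).
assert (S5y := S5 y ltac:(lra)); specialize (S5 x ltac:(lra)).
assert (S6' : (kap + G) * x + y <= 1 / 4).
{ assert (S6x := S6 (Rmax x y)); assert (Mx := Rmax_l x y); assert (My := Rmax_r x y).
  assert ((kap + G) * x <= (kap + G) * Rmax x y) by (apply Rmult_le_compat_l; lra).
  assert (Rmax x y <= eps) by (apply Rmax_lub; lra); lra. }
assert (S31 := Rmin_l (r / 4) (eta / 2)); assert (S32 := Rmin_r (r / 4) (eta / 2)).
assert (S51 := Rmin_l 1 (Rmin (eta / 2) (r / 4))).
assert (S52 := Rmin_r 1 (Rmin (eta / 2) (r / 4))).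
assert (S53 := Rmin_l (eta / 2) (r / 4)); assert (S54 := Rmin_r (eta / 2) (r / 4)).
assert (Hy2 : 0 <= y ^ 2 <= y).
{ split; [apply pow2_ge_0|].
  assert (y * y <= y * 1) by (apply Rmult_le_compat_l; lra); lra. }
destruct (phase_exists b g lam (kap * x * lam) Db) as [phi [a [P0 [A0 [Dphi Da]]]]].
assert (Kx : 0 < kap * x) by (apply Rmult_lt_0_compat; lra).
assert (PB := perturbation_bounds b g g1 g2 phi lam kap x beta G ltac:(lra) Hix Hkap Hbeta
  Db Dg Dg1 Dphi (fun t => proj2 (Hm t)) BG BG1 BG2 S1 S2 ltac:(lra)).
assert (OS := modulated_oscillation b g g1 phi a lam (kap * x) D ltac:(lra) Db Dg Dphi Da).
cbv zeta in PB, OS.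
set (N := fun t => - 2 * (kap * x) * exp (2 * b t) * sin (2 * phi t)
             - (kap * x * sin (phi t) ^ 2 - g t / lam) ^ 2 + g1 t / lam ^ 2).
change ((forall t, Rabs (N t) <= 4 * kap * beta * x) /\
  (forall t s, Rabs (N t - N s) <= 8 * kap * beta ^ 2 * lam * x * Rabs (t - s))) in PB.
destruct PB as [NB NL].
set (d := fun t => exp (2 * b t) ^ 2 + (D / lam) ^ 2 + N t).
assert (Ed : forall t, d t = M t + y ^ 2 + N t) by (intros t; unfold d; rewrite Eb; reflexivity).
assert (PSd : PS mu1 mu2 alpha H d).
{ split.
  - intros t _; rewrite Ed; specialize (MB t); specialize (NB t).
    apply Rabs_le_between in NB; lra.
  - intros t s _ _; rewrite !Ed.
    replace (M t + y ^ 2 + N t - (M s + y ^ 2 + N s)) with (M t + N t - (M s + N s)) by ring.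
    apply (holder_sum M N H alpha eta L rho (4 * kap * beta * x)); auto.
    + eapply Rle_trans; [|exact Hrs]; apply Rmult_le_compat_r; [apply Rlt_le, exp_pos|lra].
    + intros t' s'; destruct (MVT_everywhere M M1 s' t' DM) as [u [_ ->]].
      apply Rabs_mult_le; [apply HL|apply Rle_refl].
    + lra.
    + intros t' s' Hts.
      replace (H / 2) with (8 * kap * beta * x * Rpower beta alpha * Rpower lam alpha).
      * apply perturbation_holder; auto; try lra.
        -- assert (0 < kap * beta * x); [|lra].
           apply Rmult_lt_0_compat; [apply Rmult_lt_0_compat|]; lra.
        -- intros t''; eapply Rle_trans; [apply NB|]; lra.
        -- intros t'' s''; eapply Rle_trans; [apply NL|]; right; ring.
      * unfold x; rewrite Rpower_Ropp; unfold kap.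
        assert (Hla : 0 < Rpower lam alpha) by apply exp_pos.
        assert (Hmb : Rpower mu2 ((1 + alpha) / 2) = beta * Rpower beta alpha).
        { rewrite <- Hbeta2, <- Rpower_pow, Rpower_mult by exact Hbeta.
          rewrite <- (Rpower_1 beta) at 2 by exact Hbeta; rewrite <- Rpower_plus.
          f_equal; simpl; field. }
        rewrite Hmb; assert (0 < Rpower beta alpha) by apply exp_pos; field; lra. }
exists d; split; [exact PSd|split].
- exists (3 / 4 * r); split; [lra|]; intros t Ht; rewrite Ed.
  replace (c t - (M t + y ^ 2 + N t)) with (- (M t - c t) - y ^ 2 - N t) by ring.
  specialize (Mc t Ht); specialize (NB t).
  apply Rle_trans with (r / 4 + r / 4 + r / 4); [|lra].
  apply Rabs_minus_le; [apply Rabs_minus_le|]; [rewrite Rabs_Ropp|rewrite Rabs_right|]; lra.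
- destruct OS as [Dw Dw1].
  set (P := fun t => exp (a t - D * t - b t - b 0) / lam) in *.
  set (w := fun t => P t * sin (phi t)) in *.
  set (w1 := fun t => P t * ((kap * x * lam * sin (phi t) ^ 2 - g t - D) * sin (phi t)
      + lam * exp (2 * b t) * cos (phi t))) in *.
  assert (Ek : kap * Rpower lam (1 - alpha) = kap * x * lam).
  { unfold x; rewrite Rmult_assoc; f_equal; rewrite <- (Rpower_1 lam) at 3 by lra.
    rewrite <- Rpower_plus; f_equal; ring. }
  destruct (energy_lower_robust w w1 d lam delta sigma (kap * x * lam) T mu2
     (5 / 8 * (Rmin 1 mu1 / mu2)) (mu1 * Rmin 1 mu1 / (2 * mu2 ^ 2)))
     as [r0 [Hr0 Hrob]]; try lra; auto.
  + apply Rmult_le_pos; lra.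
  + apply mu3_lt; lra.
  + unfold w; rewrite P0, sin_0; ring.
  + unfold w1, P; rewrite P0, A0, sin_0, cos_0.
    replace (0 - D * 0 - b 0 - b 0) with (- (2 * b 0)) by ring; rewrite exp_Ropp.
    assert (He := exp_pos (2 * b 0)); field; lra.
  + intros t Ht; fold D.
    apply (weighted_energy_lower (a t) (b t) (b 0) (phi t)
       (kap * x * lam * sin (phi t) ^ 2 - g t - D) (exp (2 * b t)) lam D (kap * x * lam) t mu1 mu2);
      try lra; auto.
    * rewrite Eb; specialize (MB t); lra.
    * rewrite Eb; specialize (MB 0); lra.
    * assert (EG := exponent_growth b g phi a lam (kap * x) A G Kx Db Dphi Da P0 A0 HA BG t ltac:(lra)).
      assert (kap * x * (A / 2 + G * A * t) <= kap * x * (A / 2 + G * A * T)).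
      { apply Rmult_le_compat_l; [lra|]; apply Rplus_le_compat_l, Rmult_le_compat_l; [|lra].
        apply Rmult_le_pos; lra. }
      lra.
    * replace ((kap * x * lam * sin (phi t) ^ 2 - g t - D) / lam)
        with (kap * x * sin (phi t) ^ 2 - g t * / lam - y) by (unfold y; field; lra).
      apply Rle_trans with ((1 / 4) ^ 2); [|lra]; apply pow_maj_Rabs.
      eapply Rle_trans; [|exact S6'].
      replace ((kap + G) * x + y) with (kap * x * 1 + G * x + y) by ring.
      assert (Hil : 0 < / lam) by (apply Rinv_0_lt_compat; lra).
      apply Rabs_minus_le; [apply Rabs_minus_le; apply Rabs_mult_le|]; auto.
      -- rewrite Rabs_right; lra.
      -- assert (Hss := sin_sq_bounds (phi t)); rewrite Rabs_right; lra.
      -- rewrite Rabs_right; lra.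
      -- rewrite Rabs_right; lra.
  + exists r0; split; [exact Hr0|]; intros e He Hde v v' Hv t Ht.
    replace (- kap * Rpower lam (1 - alpha) * t + 2 * delta * Rpower lam (2 * sigma) * t)
      with (- (kap * x * lam) * t + 2 * D * t) by (unfold D; rewrite <- Ek; ring).
    apply (Hrob e); auto.
    intros s Hs; destruct He as [He _]; specialize (He s Hs); lra.
Qed.

Lemma PS_cont_nonneg (mu1 mu2 alpha H : R) (c : R -> R) :
  0 < alpha -> 0 < H -> PS mu1 mu2 alpha H c -> cont_nonneg c.
Proof.
intros Ha HH [_ Hc] t Ht eps Heps.
destruct (Rpower_holder_small H alpha (eps / 2)) as [h [Hh Hs]]; [lra..|].
exists h; split; [exact Hh|]; intros s Hs0 Hst.
destruct (Req_dec s t) as [->|NE].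
- unfold Rminus; rewrite Rplus_opp_r, Rabs_R0; exact Heps.
- assert (0 < Rabs (s - t)) by (apply Rabs_pos_lt; lra).
  specialize (Hc s t Hs0 Ht); specialize (Hs (Rabs (s - t))); lra.
Qed.

Lemma udist_lt_refl (c : R -> R) (r : R) : 0 < r -> udist_lt c c r.
Proof.
intros Hr; exists 0; split; [exact Hr|]; intros t _.
unfold Rminus; rewrite Rplus_opp_r, Rabs_R0; apply Rle_refl.
Qed.

Lemma udist_lt_triangle (c d e : R -> R) (r s : R) :
  udist_lt c d r -> udist_lt d e s -> udist_lt c e (r + s).
Proof.
intros [r' [Hr Hcd]] [s' [Hs Hde]]; exists (r' + s'); split; [lra|]; intros t Ht.
replace (c t - e t) with ((c t - d t) + (d t - e t)) by ring.
apply Rabs_plus_le; auto.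
Qed.

Theorem mainTheorem9 (mu1 mu2 alpha H delta sigma : R) (lam : nat -> R) :
  0 < mu1 -> mu1 < mu2 -> 0 < alpha < 1 -> 0 < H -> 0 <= delta -> 0 < sigma < 1 / 2 ->
  (forall i, 0 < lam i) ->
  (forall M, exists N : nat, forall i, (N <= i)%nat -> M < lam i) ->
  let mu3 := mu1 * Rmin 1 mu1 / (2 * mu2 ^ 2) in
  let mu5 := H / (16 * Rpower mu2 ((1 + alpha) / 2)) in
  residual_in (PS mu1 mu2 alpha H)
    (fun c => PS mu1 mu2 alpha H c /\ universal_activator alpha delta sigma lam mu3 mu5 c).
Proof.
intros Hmu1 Hmu2 Ha HH Hdelta Hsigma Hlam Hinf mu3 mu5.
exists (fun n c => PS mu1 mu2 alpha H c /\ exists i, (n <= i)%nat /\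
  activates_near mu1 mu2 alpha H delta sigma mu3 mu5 (INR n) (lam i) c).
split; [intros n; split; [split|]|].
- intros c [Hc _]; exact Hc.
- intros c [Hc [i [Hi [r [Hr Hact]]]]]; exists (r / 2); split; [lra|].
  intros d Hd Hcd; split; [exact Hd|]; exists i; split; [exact Hi|].
  exists (r / 2); split; [lra|]; intros e He Hde; apply Hact; [exact He|].
  replace r with (r / 2 + r / 2) by field; eapply udist_lt_triangle; eassumption.
- intros c Hc r Hr.
  destruct (activating_speed_near mu1 mu2 alpha H delta sigma (INR n) r c) as [L HL]; auto.
  { apply pos_INR. }
  destruct (Hinf L) as [N HN].
  destruct (HL (lam (max n N))) as [d [Hd [Hcd Hact]]]; [apply HN; lia|].
  exists d; split; [|exact Hcd]; split; [exact Hd|].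
  exists (max n N); split; [lia|exact Hact].
- intros c Hc HU; split; [exact Hc|]; split; [apply (PS_cont_nonneg mu1 mu2 alpha H); auto; lra|].
  intros w w' Hw t Ht eps Heps N.
  destruct (INR_unbounded t) as [n0 Hn0].
  destruct (HU (max N n0)) as [_ [i [Hi [r [Hr Hact]]]]].
  exists i; split; [lia|].
  apply Rlt_trans with mu3; [lra|].
  apply (Hact c Hc (udist_lt_refl c r Hr) (w i) (w' i) (Hw i)).
  split; [exact Ht|].
  assert (INR n0 <= INR (max N n0)) by (apply le_INR; lia); lra.
Qed.
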